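(* Let $Q\succ 0$, $P\succ 0$ (symmetric matrices of size $\mathsf f+n_u\mathsf v$) and $\gamma\in[0,1)$ satisfy $Q+\gamma^2P\preceq P$. Suppose that $(y^\circ,\mathbf u^\circ,y^\circ)\in\widetilde{\mathbb S}$ and that $x_0\in\mathbb X_N$. Then, for every sequence of realizations $\theta_t\in\Theta$, $w_t\in\mathbb W$ ($t\in\mathbb N$), the closed-loop dynamics $x_{t+1}=f(x_t,\mu(x_t),\theta_t)+w_t$ satisfy: (i) the tube MPC problem $\mathcal P(x_t)$ (defined in the context) remains feasible for all $t\in\mathbb N$, i.e. $x_t\in\mathbb X_N$ for all $t$; (ii) $\lim_{t\to\infty}\mathcal O(x_t)=0$, and $\lim_{t\to\infty}\bigl(y_k^*(x_t),\mathbf u_k^*(x_t)\bigr)=(y^\circ,\mathbf u^\circ)$ for every $k\in\{0,\dots,N\}$.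
   Context: System. $\mathbb X\subset\mathbb R^{n_x}$, $\mathbb U\subset\mathbb R^{n_u}$, $\mathbb W\subset\mathbb R^{n_x}$, $\Theta\subset\mathbb R^{n_\theta}$ are nonempty, compact, convex sets containing the origin, and $\Theta=\operatorname{conv}\{\theta_1,\dots,\theta_{\mathsf p}\}$ is a polytope. Put $\mathcal Z=\mathbb X\times\mathbb U\times\Theta$. The map $f:\mathcal Z\to\mathbb R^{n_x}$ admits a difference-of-convex (DC) decomposition $f_i=g_i-h_i$, $i=1,\dots,n_x$, with $g_i,h_i:\mathcal Z\to\mathbb R$ finite-valued convex. The uncertain system is $x_{t+1}=f(x_t,u_t,\theta_t)+w_t$ with arbitrary $\theta_t\in\Theta$, $w_t\in\mathbb W$. Vector inequalities are componentwise. Directional bounds. Fix $\bar z\in\operatorname{ri}(\mathcal Z)$ (relative interior) and subgradients $s_{g_i}\in\partial g_i(\bar z)$, $s_{h_i}\in\partial h_i(\bar z)$; set $g_i^L(z)=g_i(\bar z)+s_{g_i}^\top(z-\bar z)$ and $h_i^L(z)=h_i(\bar z)+s_{h_i}^\top(z-\bar z)$. For $c\in\mathbb R^{n_x}$ and $z\in\mathcal Z$ let $$\widetilde f(z;\bar z,c)=\sum_{i:\,c_i\ge0}c_i\bigl(g_i(z)-h_i^L(z)\bigr)+\sum_{i:\,c_i<0}c_i\bigl(g_i^L(z)-h_i(z)\bigr).$$ Template. $F\in\mathbb R^{\mathsf f\times n_x}$ is a fixed matrix with rows $F_1,\dots,F_{\mathsf f}$ such that $Fx\le0$ implies $x=0$.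 For $y\in\mathbb R^{\mathsf f}$, $X(y)=\{x\in\mathbb R^{n_x}\mid Fx\le y\}$. A matrix $E$ and matrices $W_1,\dots,W_{\mathsf v}\in\mathbb R^{n_x\times\mathsf f}$ are given (so that $\langle F,E,\{W_j\}\rangle$ is a ''configuration triple'') such that $X(y)=\operatorname{conv}\{W_1y,\dots,W_{\mathsf v}y\}$ for all $y$ with $Ey\le0$. Define $\widetilde f_F(x,u,\theta)\in\mathbb R^{\mathsf f}$ as the vector with $l$-th entry $\widetilde f((x,u,\theta);\bar z,F_l^\top)$, and $d\in\mathbb R^{\mathsf f}$ by $d_l=\max_{w\in\mathbb W}F_lw$. Vertex inputs. For $\mathbf u=(u_1,\dots,u_{\mathsf v})\in\mathbb R^{n_u\mathsf v}$, $U_j\mathbf u=u_j\in\mathbb R^{n_u}$. Propagation set. $\widetilde{\mathbb S}\subseteq\mathbb R^{\mathsf f}\times\mathbb R^{n_u\mathsf v}\times\mathbb R^{\mathsf f}$ is the set of all $(y,\mathbf u,y^+)$ such that $Ey\le0$ and, for all $j\in\{1,\dots,\mathsf v\}$, $k\in\{1,\dots,\mathsf p\}$: $W_jy\in\mathbb X$, $U_j\mathbf u\in\mathbb U$, and $\widetilde f_F(W_jy,U_j\mathbf u,\theta_k)+d\le y^+$. Tube MPC problem. Fix an integer $N\ge1$ and a target pair $(y^\circ,\mathbf u^\circ)\in\mathbb R^{\mathsf f}\times\mathbb R^{n_u\mathsf v}$. With $\|v\|_M^2=v^\top Mv$, let $L(y,\mathbf u)=\|(y-y^\circ,\mathbf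 u-\mathbf u^\circ)\|_Q^2$ and $L_N(y,\mathbf u)=\|(y-y^\circ,\mathbf u-\mathbf u^\circ)\|_P^2$. For $x\in\mathbb X$, problem $\mathcal P(x)$ is: minimize $\sum_{k=0}^{N-1}L(y_k,\mathbf u_k)+L_N(y_N,\mathbf u_N)$ over $y_0,\dots,y_N\in\mathbb R^{\mathsf f}$, $\mathbf u_0,\dots,\mathbf u_N\in\mathbb R^{n_u\mathsf v}$ subject to $Fx\le y_0$; $(y_k,\mathbf u_k,y_{k+1})\in\widetilde{\mathbb S}$ for $k=0,\dots,N-1$; and $(y_N,\mathbf u_N,\gamma y_N+(1-\gamma)y^\circ)\in\widetilde{\mathbb S}$. Let $\mathbb X_N=\{x\in\mathbb X\mid\mathcal P(x)\text{ is feasible}\}$. For $x\in\mathbb X_N$, $\mathcal O(x)$ is the optimal value of $\mathcal P(x)$ and $\{y_k^*(x)\}_{k=0}^N,\{\mathbf u_k^*(x)\}_{k=0}^N$ is an optimizer (it is assumed that the minimum is attained whenever $\mathcal P(x)$ is feasible). Feedback law. Fix $R\succ0$ and let $\Delta^{\mathsf v-1}=\{\lambda\in\mathbb R^{\mathsf v}\mid\lambda\ge0,\ \sum_j\lambda_j=1\}$. For $x\in\mathbb X_N$, $\lambda^*(x)$ is any minimizer of $\bigl\|\sum_j\lambda_jU_j\mathbf u_0^*(x)\bigr\|_R^2$ over $\lambda\in\Delta^{\mathsf v-1}$ subject to $x=\sum_j\lambda_jW_jy_0^*(x)$, and $\mu(x)=\sum_{j=1}^{\mathsf v}\lambda_j^*(x)U_j\mathbf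 u_0^*(x)$. *)

(* Defs.v *)
(* MathComp-Analysis, over an arbitrary [R : realType]; R^n is ['cV[R]_n]. *)
From HB Require Import structures.
From mathcomp Require Import all_boot all_order all_algebra.
From mathcomp Require Import all_classical all_reals all_analysis.

Set Implicit Arguments.
Unset Strict Implicit.
Unset Printing Implicit Defensive.

Import Order.TTheory GRing.Theory Num.Theory.
Import numFieldNormedType.Exports.

Local Open Scope classical_set_scope.
Local Open Scope ring_scope.

Section Convexity.
Context {R : realType}.

Definition vle n (a b : 'cV[R]_n) := forall i, a i 0 <= b i 0.

Definition dotv n (a b : 'cV[R]_n) : R := (a^T *m b) 0 0.

Definition sqnorm n (M : 'M[R]_n) (v : 'cV[R]_n) : R := (v^T *m M *m v) 0 0.

Definition posdef n (M : 'M[R]_n) :=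
  M^T = M /\ forall v : 'cV[R]_n, v != 0 -> 0 < sqnorm M v.

Definition possemidef n (M : 'M[R]_n) :=
  M^T = M /\ forall v : 'cV[R]_n, 0 <= sqnorm M v.

Definition loewner_le n (A B : 'M[R]_n) := possemidef (B - A).

Definition is_max (A : set R) (m : R) := A m /\ ubound A m.

Definition simplex n : set 'cV[R]_n :=
  [set l | (forall j, 0 <= l j 0) /\ \sum_j l j 0 = 1].

Definition conv_hull n m (p : 'I_m -> 'cV[R]_n) : set 'cV[R]_n :=
  [set \sum_j l j 0 *: p j | l in @simplex m].

Definition affine_hull n (A : set 'cV[R]_n) : set 'cV[R]_n :=
  [set x | exists m (a : 'I_m -> R) (p : 'I_m -> 'cV[R]_n),
    [/\ \sum_j a j = 1, forall j, A (p j) & x = \sum_j a j *: p j]].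

Definition relint n (A : set 'cV[R]_n) : set 'cV[R]_n :=
  [set x | A x /\ \forall x' \near within (affine_hull A) (nbhs x), A x'].

(* Subdifferential at [z0] of a function whose effective domain is [D]. *)
Definition subdiff n (D : set 'cV[R]_n) (phi : 'cV[R]_n -> R) (z0 : 'cV[R]_n) :
    set 'cV[R]_n :=
  [set s | forall z, D z -> phi z0 + dotv s (z - z0) <= phi z].

Definition polyhedron m n (F : 'M[R]_(m, n)) (y : 'cV[R]_m) : set 'cV[R]_n :=
  [set x | vle (F *m x) y].

Definition convex_body n (A : set 'cV[R]_n) :=
  [/\ A !=set0, compact A, convex_set A & A 0].

End Convexity.

(* The functions [dyn], [g_], [h_] are total, but only their values on
   [Zset] below are ever constrained. *)
Record tube_data (R : realType) (nx nu nth nf nv np ne : nat) := TubeData {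
  Xset : set 'cV[R]_nx;
  Uset : set 'cV[R]_nu;
  Wset : set 'cV[R]_nx;
  Tset : set 'cV[R]_nth;
  tvert : 'I_np -> 'cV[R]_nth;
  dyn : 'cV[R]_(nx + nu + nth) -> 'cV[R]_nx;
  g_ : 'I_nx -> 'cV[R]_(nx + nu + nth) -> R;
  h_ : 'I_nx -> 'cV[R]_(nx + nu + nth) -> R;
  zbar : 'cV[R]_(nx + nu + nth);
  sg_ : 'I_nx -> 'cV[R]_(nx + nu + nth);
  sh_ : 'I_nx -> 'cV[R]_(nx + nu + nth);
  Fmx : 'M[R]_(nf, nx);
  Emx : 'M[R]_(ne, nf);
  Wmx : 'I_nv -> 'M[R]_(nx, nf);
  dvec : 'cV[R]_nf }.

Section Tube.
Context {R : realType} {nx nu nth nf nv np ne : nat}.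
Variable D : tube_data R nx nu nth nf nv np ne.

Definition xut (x : 'cV[R]_nx) (u : 'cV[R]_nu) (th : 'cV[R]_nth) :
  'cV[R]_(nx + nu + nth) := col_mx (col_mx x u) th.

Definition Zset : set 'cV[R]_(nx + nu + nth) :=
  [set z | exists x u th,
    [/\ Xset D x, Uset D u, Tset D th & z = xut x u th]].

Record standing_assumptions : Prop := StandingAssumptions {
  Xset_body : convex_body (Xset D);
  Uset_body : convex_body (Uset D);
  Wset_body : convex_body (Wset D);
  Tset_body : convex_body (Tset D);
  Tset_polytope : Tset D = conv_hull (tvert D);
  g_convex : forall i, convex_function Zset (g_ D i);
  h_convex : forall i, convex_function Zset (h_ D i);
  dyn_dc : forall z, Zset z -> forall i, dyn D z i 0 = g_ D i z - h_ D i z;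
  zbar_relint : relint Zset (zbar D);
  sg_subdiff : forall i, subdiff Zset (g_ D i) (zbar D) (sg_ D i);
  sh_subdiff : forall i, subdiff Zset (h_ D i) (zbar D) (sh_ D i);
  Fmx_pointed : forall x, vle (Fmx D *m x) 0 -> x = 0;
  configuration : forall y, vle (Emx D *m y) 0 ->
    polyhedron (Fmx D) y = conv_hull (fun j => Wmx D j *m y);
  dvec_max : forall l, is_max [set (Fmx D *m w) l 0 | w in Wset D] (dvec D l 0)
}.

Definition gL i z : R := g_ D i (zbar D) + dotv (sg_ D i) (z - zbar D).

Definition hL i z : R := h_ D i (zbar D) + dotv (sh_ D i) (z - zbar D).

Definition ftilde (c : 'cV[R]_nx) z : R :=
  \sum_(i < nx | 0 <= c i 0) c i 0 * (g_ D i z - hL i z) +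
  \sum_(i < nx | c i 0 < 0) c i 0 * (gL i z - h_ D i z).

Definition ftildeF x u th : 'cV[R]_nf :=
  \col_l ftilde (row l (Fmx D))^T (xut x u th).

(* A vector of vertex inputs stacks the blocks u_1, ..., u_nv, of size nu. *)
Definition Ublk (j : 'I_nv) (u : 'cV[R]_(nv * nu)) : 'cV[R]_nu :=
  \col_i u (mxvec_index j i) 0.

Definition propagation :
    set ('cV[R]_nf * 'cV[R]_(nv * nu) * 'cV[R]_nf) :=
  [set s | let: (y, u, yp) := s in
    vle (Emx D *m y) 0 /\
    forall (j : 'I_nv) (k : 'I_np),
      [/\ Xset D (Wmx D j *m y), Uset D (Ublk j u) &
          vle (ftildeF (Wmx D j *m y) (Ublk j u) (tvert D k) + dvec D) yp]].

Section MPC.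
Variables (N : nat) (yo : 'cV[R]_nf) (uo : 'cV[R]_(nv * nu)) (gamma : R).
Variables (Q P : 'M[R]_(nf + nv * nu)).

Definition quad_cost (M : 'M[R]_(nf + nv * nu)) (y : 'cV[R]_nf)
    (u : 'cV[R]_(nv * nu)) : R :=
  sqnorm M (col_mx (y - yo) (u - uo)).

Definition mpc_cost (y : 'I_N.+1 -> 'cV[R]_nf)
    (u : 'I_N.+1 -> 'cV[R]_(nv * nu)) : R :=
  \sum_(k < N) quad_cost Q (y (inord k)) (u (inord k)) +
  quad_cost P (y ord_max) (u ord_max).

Definition mpc_feasible (x : 'cV[R]_nx) (y : 'I_N.+1 -> 'cV[R]_nf)
    (u : 'I_N.+1 -> 'cV[R]_(nv * nu)) :=
  [/\ vle (Fmx D *m x) (y ord0),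
      forall k : 'I_N, propagation (y (inord k), u (inord k), y (inord k.+1)) &
      propagation (y ord_max, u ord_max,
                   gamma *: y ord_max + (1 - gamma) *: yo)].

Definition feasible_states : set 'cV[R]_nx :=
  [set x | Xset D x /\ exists y u, mpc_feasible x y u].

(* [inf] is 0 on the empty set, so this is meaningful on [feasible_states]. *)
Definition mpc_value (x : 'cV[R]_nx) : R :=
  inf [set r | exists y u, mpc_feasible x y u /\ r = mpc_cost y u].

Definition mpc_optimizer (x : 'cV[R]_nx) (y : 'I_N.+1 -> 'cV[R]_nf)
    (u : 'I_N.+1 -> 'cV[R]_(nv * nu)) :=
  mpc_feasible x y u /\
  forall y' u', mpc_feasible x y' u' -> mpc_cost y u <= mpc_cost y' u'.

End MPC.

Definition blend (l : 'cV[R]_nv) (u : 'cV[R]_(nv * nu)) : 'cV[R]_nu :=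
  \sum_j l j 0 *: Ublk j u.

Definition weight_feasible (x : 'cV[R]_nx) (y : 'cV[R]_nf) (l : 'cV[R]_nv) :=
  simplex l /\ x = \sum_j l j 0 *: (Wmx D j *m y).

Definition weight_optimizer (Ru : 'M[R]_nu) (x : 'cV[R]_nx) (y : 'cV[R]_nf)
    (u : 'cV[R]_(nv * nu)) (l : 'cV[R]_nv) :=
  weight_feasible x y l /\
  forall l', weight_feasible x y l' ->
    sqnorm Ru (blend l u) <= sqnorm Ru (blend l' u).

End Tube.

(* Main.v *)
(* The tube shifted by one stage, completed by the contraction of its last
   element towards the target, is feasible at the next state: the propagation
   set is convex because its constraints are convex in [z], and the convex
   sublevel set [ftilde_F <= y^+ - d], which contains every vertex triple,
   contains the actual [(x, mu x, theta)].  With [Q + gamma^2 P <= P] this gives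
   [O(x_{t+1}) <= O(x_t) - L(y_0, u_0)], hence [L(y_0, u_0) --> 0].
   Since the value function need not be continuous at the target, convergence of
   the later stages is not read off that of stage 0.  Instead, the costs of the
   shifted tube and of the next optimizer differ by at most
   [O(x_t) - O(x_{t+1}) --> 0], so by strong convexity of the cost over the
   convex feasible set the two tubes merge: stage [k.+1] at time [t] is
   asymptotically stage [k] at time [t.+1], and convergence propagates from
   stage 0 to all stages. *)
Require Import Defs.
From HB Require Import structures.
From mathcomp Require Import all_boot all_order all_algebra.
From mathcomp Require Import all_classical all_reals all_analysis.
From mathcomp Require Import ring lra.

Set Implicit Arguments.
Unset Strict Implicit.
Unset Printing Implicit Defensive.

Import Order.TTheory GRing.Theory Num.Theory.
Import numFieldNormedType.Exports.

Local Open Scope classical_set_scope.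
Local Open Scope ring_scope.

(** * Scalar sequences tending to zero *)

Lemma cvg_sum0 {R : realType} {I : Type} (r : seq I) (f : I -> nat -> R) :
  (forall i, f i t @[t --> \oo] --> 0) ->
  \sum_(i <- r) f i t @[t --> \oo] --> 0.
Proof.
move=> f0; elim: r => [|i r IH].
  by under eq_fun do rewrite big_nil; exact: cvg_cst.
by under eq_fun do rewrite big_cons; rewrite -[X in nbhs X]addr0; exact: cvgD.
Qed.

Lemma cvg_mul0l {R : realType} (f : nat -> R) (c : R) :
  f t @[t --> \oo] --> 0 -> c * f t @[t --> \oo] --> 0.
Proof. by move=> f0; have := cvgM (cvg_cst c) f0; rewrite mulr0; apply. Qed.

(** * Quadratic forms: parallelogram identity, Cauchy-Schwarz, and convergence *)

Section QuadraticForms.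
Context {R : realType} {n : nat}.
Implicit Types (M : 'M[R]_n) (a b v : 'cV[R]_n).

Definition bilin M a b : R := (a^T *m M *m b) 0 0.

Lemma bilinDl M a b v : bilin M (a + b) v = bilin M a v + bilin M b v.
Proof. by rewrite /bilin linearD /= !mulmxDl mxE. Qed.

Lemma bilinDr M a b v : bilin M v (a + b) = bilin M v a + bilin M v b.
Proof. by rewrite /bilin mulmxDr mxE. Qed.

Lemma bilinZl M c a b : bilin M (c *: a) b = c * bilin M a b.
Proof. by rewrite /bilin linearZ /= -!scalemxAl mxE. Qed.

Lemma bilinZr M c a b : bilin M a (c *: b) = c * bilin M a b.
Proof. by rewrite /bilin -!scalemxAr mxE. Qed.

Lemma bilinC M a b : M^T = M -> bilin M a b = bilin M b a.
Proof.
move=> sM; rewrite /bilin; set X := _ *m b.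
by rewrite -[X in LHS]trmxK [LHS]mxE /X !trmx_mul trmxK sM mulmxA.
Qed.

Lemma sqnormE M v : sqnorm M v = bilin M v v.
Proof. by []. Qed.

Lemma sqnormD M a b :
  sqnorm M (a + b) = sqnorm M a + (bilin M a b + bilin M b a) + sqnorm M b.
Proof. by rewrite !sqnormE !bilinDl !bilinDr; ring. Qed.

Lemma sqnormZ M c v : sqnorm M (c *: v) = c ^+ 2 * sqnorm M v.
Proof. by rewrite !sqnormE bilinZl bilinZr; ring. Qed.

Lemma sqnormDmx M M' v : sqnorm (M + M') v = sqnorm M v + sqnorm M' v.
Proof. by rewrite /sqnorm mulmxDr mulmxDl mxE. Qed.

Lemma sqnormZmx M c v : sqnorm (c *: M) v = c * sqnorm M v.
Proof. by rewrite /sqnorm -scalemxAr -scalemxAl mxE. Qed.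

Lemma sqnorm0 M : sqnorm M 0 = 0.
Proof. by rewrite /sqnorm mulmx0 mxE. Qed.

(** Parallelogram identity; its last term measures the strong convexity of the cost. The weights
    have the form [t], [1 - t] shared by the convexity lemmas below. *)
Lemma sqnorm_midpoint M a b :
  sqnorm M (2^-1 *: a + (1 - 2^-1) *: b) =
  2^-1 * sqnorm M a + 2^-1 * sqnorm M b - 4^-1 * sqnorm M (a - b).
Proof.
by rewrite !sqnormD !sqnormZ -(scaleN1r b) !bilinZl !bilinZr sqnormZ; field.
Qed.

Lemma posdef_ge0 M v : posdef M -> 0 <= sqnorm M v.
Proof.
move=> [_ pM]; have [->|v0] := eqVneq v 0; first by rewrite sqnorm0.
exact/ltW/pM.
Qed.

(** With A, B the squared norms of [a], [b] and c their product, the form at B a - c b equals B (A B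
    - c^2), which is nonnegative; B > 0 cancels when [b] is nonzero. *)
Lemma posdef_cauchy_schwarz M a b : posdef M ->
  bilin M a b ^+ 2 <= sqnorm M a * sqnorm M b.
Proof.
move=> pM; have [->|b0] := eqVneq b 0.
  by rewrite sqnorm0 /bilin mulmx0 mxE expr0n mulr0.
have Bgt0 : 0 < sqnorm M b by apply pM.
have /(posdef_ge0) := pM => /(_ (sqnorm M b *: a + - bilin M a b *: b)).
rewrite sqnormD !sqnormZ !bilinZl !bilinZr (bilinC b a pM.1).
set A := sqnorm M a; set B := sqnorm M b in Bgt0 *; set c := bilin M a b.
rewrite (_ : _ + _ = B * (A * B - c ^+ 2)); last by ring.
by rewrite pmulr_rge0 // subr_ge0.
Qed.

Lemma posdef_unitmx M : posdef M -> M \in unitmx.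
Proof.
move=> [_ pM]; rewrite -row_free_unit -kermx_eq0; apply/rowV0P => u.
move=> /sub_kermxP uM0; apply/eqP; apply: contraT => u0.
have := pM u^T; rewrite /sqnorm trmxK uM0 mul0mx mxE ltxx => -> //.
by rewrite -(inj_eq (@trmx_inj _ _ _)) trmxK trmx0.
Qed.

(** The coordinate v_i is the M-product of M^-1 e_i with v, so Cauchy-Schwarz bounds it. This
    replaces a bound by the smallest eigenvalue. *)
Lemma posdef_coord_le M (i : 'I_n) : posdef M ->
  exists K, forall v, v i 0 ^+ 2 <= K * sqnorm M v.
Proof.
move=> pM; pose a : 'cV[R]_n := invmx M *m delta_mx i 0.
exists (sqnorm M a) => v; apply: le_trans (posdef_cauchy_schwarz a v pM).
rewrite bilinC; last exact: pM.1.
rewrite /bilin /a -!mulmxA mulKVmx; last exact: posdef_unitmx.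
rewrite (_ : (_ *m _) 0 0 = v i 0) // mxE (bigD1 i) //= big1.
  by rewrite !mxE !eqxx addr0 mulr1.
by move=> j /negbTE ji; rewrite !mxE ji mulr0.
Qed.

Lemma cvg_coord0 (v : nat -> 'cV[R]_n) :
  (forall i, v t i 0 @[t --> \oo] --> 0) -> v t @[t --> \oo] --> (0 : 'cV[R]_n).
Proof.
move=> v0; apply/cvgr0Pnorm_lt => e e0.
have : \forall t \near \oo, forall i, `|v t i 0| < e.
  by apply: filter_forall => i; apply: (cvgr0_norm_lt _ (v0 i)).
apply: filterS => t ve; rewrite -[ltLHS]/(mx_norm (v t)).
have [->//|/mx_norm_neq0[[i j] ->]] := eqVneq (mx_norm (v t)) 0.
by rewrite /= ord1.
Qed.

Lemma posdef_cvg0 M (v : nat -> 'cV[R]_n) : posdef M ->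
  sqnorm M (v t) @[t --> \oo] --> 0 -> v t @[t --> \oo] --> (0 : 'cV[R]_n).
Proof.
move=> pM v0; apply: cvg_coord0 => i.
have [K vK] := posdef_coord_le i pM.
have sq0 : v t i 0 ^+ 2 @[t --> \oo] --> 0.
  apply: (@squeeze_cvgr _ _ _ _ (fun=> 0) (fun t => K * sqnorm M (v t))).
  - by apply: nearW => t; rewrite sqr_ge0 /=; exact: vK.
  - exact: cvg_cst.
  - exact: cvg_mul0l.
(* The squared coordinate tends to 0; its square root is the absolute value, and the root is
   continuous at 0. *)
apply: norm_cvg0; under eq_fun do rewrite -sqrtr_sqr.
by have := cvg_comp _ _ sq0 (@sqrt_continuous R 0); rewrite sqrtr0.
Qed.

Lemma sqnorm_cvg0 M (v : nat -> 'cV[R]_n) :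
  v t @[t --> \oo] --> (0 : 'cV[R]_n) -> sqnorm M (v t) @[t --> \oo] --> 0.
Proof.
move=> v0.
have vi i : v t i 0 @[t --> \oo] --> 0.
  have := cvg_comp _ _ v0 (@coord_continuous _ _ _ i 0 0).
  by rewrite mxE.
have -> : (fun t => sqnorm M (v t)) =
    fun t => \sum_j (\sum_i M i j * v t i 0) * v t j 0.
  apply/funext => t; rewrite /sqnorm mxE; apply: eq_bigr => j _; rewrite mxE.
  by congr (_ * _); apply: eq_bigr => i _; rewrite mxE mulrC.
apply: (@cvg_sum0 _ _ _ ( fun j t => (\sum_i M i j * v t i 0) * v t j 0)) => j.
have s0 : \sum_i M i j * v t i 0 @[t --> \oo] --> 0.
  by apply: (@cvg_sum0 _ _ _ (fun i t => M i j * v t i 0)) => i; exact: cvg_mul0l.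
by have := cvgM s0 (vi j); rewrite mul0r; apply.
Qed.

End QuadraticForms.

(** * Finite convex combinations *)

Section ConvexCombinations.
Context {R : realType}.

Lemma convex_setP n (A : set 'cV[R]_n) (t : R) x y :
  convex_set A -> 0 <= t -> t <= 1 -> A x -> A y ->
  A (t *: x + (1 - t) *: y).
Proof.
move=> cA t0 t1 Ax Ay.
by have /set_mem := cA x y (Itv01 t0 t1) (mem_set Ax) (mem_set Ay).
Qed.

Lemma convex_functionP n (A : set 'cV[R]_n) (f : 'cV[R]_n -> R) (t : R) x y :
  convex_function A f -> 0 <= t -> t <= 1 -> A x -> A y ->
  f (t *: x + (1 - t) *: y) <= t * f x + (1 - t) * f y.
Proof.
move=> cf t0 t1 Ax Ay.
exact: (cf (Itv01 t0 t1) x y (mem_set Ax) (mem_set Ay)).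
Qed.

(** Induction on the number of points: the last one is split off and the other weights are divided
    by their sum S. Convexity is spelled out so that it applies directly to sublevel sets. *)
Lemma convex_set_sum n m (A : set 'cV[R]_n) (a : 'I_m -> R) p :
  (forall (t : R) x y, 0 <= t -> t <= 1 -> A x -> A y ->
     A (t *: x + (1 - t) *: y)) ->
  (forall j, 0 <= a j) -> \sum_j a j = 1 -> (forall j, A (p j)) ->
  A (\sum_j a j *: p j).
Proof.
move=> cA; elim: m a p => [a p _|m IH a p a0 a1 Ap].
  by rewrite big_ord0 => /eqP; rewrite eq_sym oner_eq0.
move: a1; rewrite !big_ord_recr /=; set S := \sum_(i < m) _ => a1.
have S0 : 0 <= S by apply: sumr_ge0 => i _; exact: a0.
have aE : a ord_max = 1 - S by rewrite -a1; ring.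
(* If S = 0, renormalising is impossible, but the sum reduces to its last point. *)
have [S00|Sn0] := eqVneq S 0.
  have z := psumr_eq0P (fun i _ => a0 (widen_ord (leqnSn m) i)) S00.
  rewrite big1 ?add0r ?aE ?S00 ?subr0 ?scale1r // => i _.
  by rewrite z ?scale0r.
rewrite aE; pose b i := a (widen_ord (leqnSn m) i) / S.
have -> : \sum_(i < m) a (widen_ord (leqnSn m) i) *: p (widen_ord (leqnSn m) i) =
    S *: \sum_(i < m) b i *: p (widen_ord (leqnSn m) i).
  by rewrite scaler_sumr; apply: eq_bigr => i _; rewrite scalerA mulrCA divff ?mulr1.
apply: cA => //; first by rewrite -subr_ge0 -aE.
apply: IH => // [j|]; first by rewrite divr_ge0.
by rewrite -mulr_suml divff.
Qed.

Lemma conv_hull_subset n m (A : set 'cV[R]_n) (p : 'I_m -> 'cV[R]_n) :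
  convex_set A -> (forall j, A (p j)) -> conv_hull p `<=` A.
Proof.
move=> cA Ap _ [l [l0 l1] <-]; apply: convex_set_sum => // t x y.
exact: convex_setP.
Qed.

Lemma dotvDr n (s a b : 'cV[R]_n) : dotv s (a + b) = dotv s a + dotv s b.
Proof. by rewrite /dotv mulmxDr mxE. Qed.

Lemma dotvZr n (s a : 'cV[R]_n) c : dotv s (c *: a) = c * dotv s a.
Proof. by rewrite /dotv -scalemxAr mxE. Qed.

Lemma dotvNr n (s a : 'cV[R]_n) : dotv s (- a) = - dotv s a.
Proof. by rewrite -scaleN1r dotvZr mulN1r. Qed.

End ConvexCombinations.

(** * Convexity of the propagation set, and one step of the uncertain dynamics *)

Section TubeConvexity.
Context {R : realType} {nx nu nth nf nv np ne : nat}.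
Variable D : tube_data R nx nu nth nf nv np ne.
Hypothesis hD : standing_assumptions D.

Lemma xut_conv (t : R) (x x' : 'cV[R]_nx) (u u' : 'cV[R]_nu) (v v' : 'cV[R]_nth) :
  t *: xut x u v + (1 - t) *: xut x' u' v' =
  xut (t *: x + (1 - t) *: x') (t *: u + (1 - t) *: u')
      (t *: v + (1 - t) *: v').
Proof. by rewrite /xut !scale_col_mx !add_col_mx. Qed.

Lemma Zset_conv (t : R) z z' : 0 <= t -> t <= 1 -> Zset D z -> Zset D z' ->
  Zset D (t *: z + (1 - t) *: z').
Proof.
case: hD => [[_ _ cX _] [_ _ cU _] _ [_ _ cT _] _ _ _ _ _ _ _ _ _ _].
move=> t0 t1 [x [u [v [Xx Uu Tv ->]]]] [x' [u' [v' [Xx' Uu' Tv' ->]]]].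
exists (t *: x + (1 - t) *: x'), (t *: u + (1 - t) *: u'), (t *: v + (1 - t) *: v').
by rewrite xut_conv; split => //; apply: convex_setP.
Qed.

Lemma gL_conv i (t : R) z z' :
  gL D i (t *: z + (1 - t) *: z') = t * gL D i z + (1 - t) * gL D i z'.
Proof. by rewrite /gL !(dotvDr, dotvZr, dotvNr); ring. Qed.

Lemma hL_conv i (t : R) z z' :
  hL D i (t *: z + (1 - t) *: z') = t * hL D i z + (1 - t) * hL D i z'.
Proof. by rewrite /hL !(dotvDr, dotvZr, dotvNr); ring. Qed.

(** Each summand is convex: a nonnegative c_i multiplies g_i minus an affine map, a negative one
    multiplies an affine map minus h_i, which is concave. *)
Lemma ftilde_conv c (t : R) z z' : 0 <= t -> t <= 1 -> Zset D z -> Zset D z' ->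
  ftilde D c (t *: z + (1 - t) *: z') <=
  t * ftilde D c z + (1 - t) * ftilde D c z'.
Proof.
move=> t0 t1 Zz Zz'.
rewrite /ftilde !mulrDr addrACA !mulr_sumr -!big_split /=.
apply: lerD; apply: ler_sum => i ci.
  rewrite hL_conv; have := convex_functionP (g_convex hD i) t0 t1 Zz Zz'.
  by nra.
rewrite gL_conv; have := convex_functionP (h_convex hD i) t0 t1 Zz Zz'.
by nra.
Qed.

(** The subgradient inequalities put the linearisations below g_i and h_i; the sign of c_i decides
    which of the two is linearised, so every replacement increases the sum. *)
Lemma dyn_le_ftilde c z : Zset D z -> dotv c (dyn D z) <= ftilde D c z.
Proof.
move=> Zz; rewrite /dotv mxE (bigID (fun i => 0 <= c i 0)) /=.
have hle i : hL D i z <= h_ D i z by exact: (sh_subdiff hD).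
have gle i : gL D i z <= g_ D i z by exact: (sg_subdiff hD).
rewrite /ftilde; under [X in _ <= _ + X]eq_bigl do rewrite ltNge.
apply: lerD; apply: ler_sum => i ci; rewrite mxE (dyn_dc hD) //.
  by rewrite ler_wpM2l // lerD2l lerN2.
by rewrite ler_wnM2l ?lerD2r // ltW // ltNge.
Qed.

Lemma sublevel_conv (y : 'cV[R]_nf) (t : R) z z' : 0 <= t -> t <= 1 ->
  (Zset D z /\ forall l, ftilde D (row l (Fmx D))^T z <= y l 0) ->
  (Zset D z' /\ forall l, ftilde D (row l (Fmx D))^T z' <= y l 0) ->
  Zset D (t *: z + (1 - t) *: z') /\
  forall l, ftilde D (row l (Fmx D))^T (t *: z + (1 - t) *: z') <= y l 0.
Proof.
move=> t0 t1 [Zz zy] [Zz' zy']; split=> [|l]; first exact: Zset_conv.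
apply: le_trans (ftilde_conv _ t0 t1 Zz Zz') _.
have := zy l; have := zy' l; nra.
Qed.

Lemma Ublk_linear j (a b : R) (u u' : 'cV[R]_(nv * nu)) :
  Ublk j (a *: u + b *: u') = a *: Ublk j u + b *: Ublk j u'.
Proof. by apply/colP => i; rewrite !mxE. Qed.

Lemma vle_conv n (t : R) (a b a' b' : 'cV[R]_n) : 0 <= t -> t <= 1 ->
  vle a b -> vle a' b' -> vle (t *: a + (1 - t) *: a') (t *: b + (1 - t) *: b').
Proof.
move=> t0 t1 ab ab' i; rewrite !mxE; have := ab i; have := ab' i; nra.
Qed.

Lemma tvert_in k : Tset D (tvert D k).
Proof.
rewrite (Tset_polytope hD); exists (delta_mx k 0).
  split=> [j|]; first by rewrite mxE ler0n.
  rewrite (bigD1 k) //= big1 ?mxE ?eqxx ?addr0 // => i /negbTE ik.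
  by rewrite mxE ik.
rewrite (bigD1 k) //= big1 ?mxE ?eqxx ?scale1r ?addr0 // => i /negbTE ik.
by rewrite mxE ik scale0r.
Qed.

Lemma propagation_conv (t : R) y u yp y' u' yp' : 0 <= t -> t <= 1 ->
  propagation D (y, u, yp) -> propagation D (y', u', yp') ->
  propagation D (t *: y + (1 - t) *: y', t *: u + (1 - t) *: u',
                 t *: yp + (1 - t) *: yp').
Proof.
move=> t0 t1 [Ey S] [Ey' S']; split=> [|j k].
  rewrite mulmxDr -!scalemxAr.
  have -> : 0 = t *: 0 + (1 - t) *: 0 :> 'cV[R]_ne by rewrite !scaler0 addr0.
  exact: vle_conv.
have [Xy Uu fy] := S j k; have [Xy' Uu' fy'] := S' j k.
rewrite mulmxDr -!scalemxAr Ublk_linear; split.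
- by apply: convex_setP => //; case: (Xset_body hD).
- by apply: convex_setP => //; case: (Uset_body hD).
move=> l; have := vle_conv t0 t1 fy fy' l; apply: le_trans.
rewrite !mxE.
have := @ftilde_conv (row l (Fmx D))^T t
  (xut (Wmx D j *m y) (Ublk j u) (tvert D k))
  (xut (Wmx D j *m y') (Ublk j u') (tvert D k)) t0 t1.
(* Both triples use the same vertex of Theta, so their combination keeps it. *)
rewrite xut_conv -[in X in ftilde _ _ (xut _ _ X)]scalerDl (subrKC t) scale1r.
have Z1 : Zset D (xut (Wmx D j *m y) (Ublk j u) (tvert D k)).
  by exists (Wmx D j *m y), (Ublk j u), (tvert D k); split => //; exact: tvert_in.
have Z2 : Zset D (xut (Wmx D j *m y') (Ublk j u') (tvert D k)).
  by exists (Wmx D j *m y'), (Ublk j u'), (tvert D k); split => //; exact: tvert_in.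
by move=> /(_ Z1 Z2); nra.
Qed.

(** The set X(y) is the hull of the points W_j y, which lie in the convex set X. In [propagation]
    that membership stands under a quantifier over the vertices of Theta, so one vertex must
    exist. *)
Lemma propagation_Xset x y u yp : (0 < np)%N ->
  propagation D (y, u, yp) -> vle (Fmx D *m x) y -> Xset D x.
Proof.
move=> np0 [Ey S] Fx; have [_ _ cX _] := Xset_body hD.
have : polyhedron (Fmx D) y x by [].
rewrite (configuration hD Ey); apply: conv_hull_subset => // j.
by have [] := S j (Ordinal np0).
Qed.

Lemma np_gt0 : (0 < np)%N.
Proof.
have [[v]] := Tset_body hD; rewrite (Tset_polytope hD) => -[l [_ l1] _] _ _ _.
rewrite lt0n; apply: contra_eqN l1 => /eqP np0.
rewrite big1 ?(eq_sym 0) ?oner_eq0 // => j.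
by have := ltn_ord j; rewrite [X in (_ < X)%N]np0.
Qed.

Lemma xut_sum m (a : 'I_m -> R) (x : 'I_m -> 'cV[R]_nx) (u : 'I_m -> 'cV[R]_nu)
    (v : 'I_m -> 'cV[R]_nth) :
  \sum_j a j *: xut (x j) (u j) (v j) =
  xut (\sum_j a j *: x j) (\sum_j a j *: u j) (\sum_j a j *: v j).
Proof.
rewrite /xut; elim: (index_enum _) => [|j r IH].
  by rewrite !big_nil !col_mx0.
by rewrite !big_cons IH !scale_col_mx !add_col_mx.
Qed.

(** The actual triple (x, mu, theta) is a double convex combination of vertex triples, all in the
    convex sublevel set [A]; there [ftilde] dominates the dynamics, and [dvec] absorbs the
    disturbance. *)
Lemma propagation_step x y u yp l v w :
  propagation D (y, u, yp) -> weight_feasible D x y l ->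
  Tset D v -> Wset D w ->
  vle (Fmx D *m (dyn D (xut x (blend l u) v) + w)) yp.
Proof.
move=> [_ S] [[l0 l1] ->]; rewrite (Tset_polytope hD) => -[b [b0 b1] <-] Ww.
pose A z := Zset D z /\
  forall i, ftilde D (row i (Fmx D))^T z <= (yp - dvec D) i 0.
have Ajk j k : A (xut (Wmx D j *m y) (Ublk j u) (tvert D k)).
  have [Xy Uu Sjk] := S j k; split=> [|i].
    by exists (Wmx D j *m y), (Ublk j u), (tvert D k); split => //; exact: tvert_in.
  by have := Sjk i; rewrite !mxE lerBrDr.
have cA t z z' := @sublevel_conv (yp - dvec D) t z z'.
(* First combine over j with the vertex of Theta fixed, then over k with state and input fixed; the
   fixed components survive because the weights sum to 1. *)
have Ak k : A (xut (\sum_j l j 0 *: (Wmx D j *m y)) (blend l u) (tvert D k)).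
  have := convex_set_sum cA l0 l1 (fun j => Ajk j k).
  by rewrite xut_sum -scaler_suml l1 scale1r.
have [Zz Fz] := convex_set_sum cA b0 b1 Ak.
move: Zz Fz; rewrite xut_sum -!scaler_suml b1 !scale1r => Zz Fz i.
have [_ dmax] := dvec_max hD i.
rewrite mulmxDr mxE.
have := dmax _ (ex_intro2 _ _ w Ww erefl).
have := Fz i; have := dyn_le_ftilde (row i (Fmx D))^T Zz.
rewrite /dotv trmxK -row_mul !mxE; lra.
Qed.

End TubeConvexity.

(** * The shifted tube: feasibility, cost decrease, and distance to the optimizer *)

Section TubeMPC.
Context {R : realType} {nx nu nth nf nv np ne N : nat}.
Variable D : tube_data R nx nu nth nf nv np ne.
Variables (yo : 'cV[R]_nf) (uo : 'cV[R]_(nv * nu)) (gamma : R).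
Variables (Q P : 'M[R]_(nf + nv * nu)).
Hypothesis hD : standing_assumptions D.

Local Notation cost := (mpc_cost (N := N) yo uo Q P).
Local Notation feasible := (mpc_feasible (N := N) D yo gamma).

Definition shift_tube n (vo : 'cV[R]_n) (v : 'I_N.+1 -> 'cV[R]_n)
    (k : 'I_N.+1) : 'cV[R]_n :=
  if (k < N)%N then v (inord k.+1)
  else gamma *: v ord_max + (1 - gamma) *: vo.

Lemma shift_tubeS n (vo : 'cV[R]_n) v (k : 'I_N) :
  shift_tube vo v (inord k) = v (inord k.+1).
Proof. by rewrite /shift_tube inordK ?ltn_ord // ltnS ltnW. Qed.

Lemma shift_tube_max n (vo : 'cV[R]_n) v :
  shift_tube vo v ord_max = gamma *: v ord_max + (1 - gamma) *: vo.
Proof. by rewrite /shift_tube ltnn. Qed.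

Lemma inord_max : inord N = ord_max :> 'I_N.+1.
Proof. by apply: val_inj; rewrite /= inordK. Qed.

Lemma shift_feasible x x' y u : (0 < N)%N -> 0 <= gamma -> gamma < 1 ->
  propagation D (yo, uo, yo) -> feasible x y u ->
  vle (Fmx D *m x') (y (inord 1)) ->
  feasible x' (shift_tube yo y) (shift_tube uo u).
Proof.
move=> N0 g0 g1 So [_ S SN] Fx'; split.
- by rewrite /shift_tube /= N0.
- move=> k; rewrite !shift_tubeS.
  have [kN|kN] := ltnP k.+1 N.
    by rewrite (shift_tubeS _ _ (Ordinal kN)); apply: (S (Ordinal kN)).
  (* For k = N - 1 the required triple is exactly the old terminal constraint. *)
  have -> : k.+1 = N by apply/eqP; rewrite eqn_leq kN ltn_ord.
  by rewrite inord_max shift_tube_max.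
(* The new terminal triple is the combination, with weight [gamma], of the old one and the target
   triple. *)
rewrite !shift_tube_max; by apply: propagation_conv => //; exact: ltW.
Qed.

Lemma quad_cost_conv_target M (t : R) y u :
  quad_cost yo uo M (t *: y + (1 - t) *: yo) (t *: u + (1 - t) *: uo) =
  t ^+ 2 * quad_cost yo uo M y u.
Proof.
rewrite /quad_cost -sqnormZ scale_col_mx; congr (sqnorm _ (col_mx _ _));
  by apply/colP => i; rewrite !mxE; ring.
Qed.

(** The shift drops the stage cost at 0, gains the one at N, and scales the terminal cost by
    gamma^2; Q + gamma^2 P <= P absorbs the gain. *)
Lemma mpc_cost_shift y u : loewner_le (Q + gamma ^+ 2 *: P) P ->
  cost (shift_tube yo y) (shift_tube uo u) <=
  cost y u - quad_cost yo uo Q (y ord0) (u ord0).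
Proof.
move=> [_ QP]; rewrite /mpc_cost !shift_tube_max quad_cost_conv_target.
under eq_bigr do rewrite !shift_tubeS.
pose f k := quad_cost yo uo Q (y (inord k)) (u (inord k)).
have fS : \sum_(k < N) f k.+1 = \sum_(k < N) f k - f 0%N + f N.
  have E : \sum_(k < N.+1) f k = f 0%N + \sum_(k < N) f k.+1.
    by rewrite big_ord_recl.
  by move: E; rewrite big_ord_recr /=; lra.
rewrite fS /f inord_max -(_ : ord0 = inord 0); last first.
  by apply: val_inj; rewrite /= inordK.
have := QP (col_mx (y ord_max - yo) (u ord_max - uo)).
rewrite -scaleN1r sqnormDmx sqnormZmx sqnormDmx sqnormZmx /quad_cost; lra.
Qed.

Lemma feasible_conv (t : R) x y u y' u' : 0 <= t -> t <= 1 ->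
  feasible x y u -> feasible x y' u' ->
  feasible x (fun k => t *: y k + (1 - t) *: y' k)
             (fun k => t *: u k + (1 - t) *: u' k).
Proof.
move=> t0 t1 [Fx S SN] [Fx' S' SN']; split.
- have := vle_conv t0 t1 Fx Fx'.
  by rewrite -scalerDl (subrKC t) scale1r.
- by move=> k; apply: propagation_conv.
(* The terminal successor is affine in the last tube parameter, so it commutes with the
   combination. *)
have := propagation_conv hD t0 t1 SN SN'.
congr (propagation _ (_, _, _)); apply/colP => i; rewrite !mxE; ring.
Qed.

Definition err (y : 'I_N.+1 -> 'cV[R]_nf) (u : 'I_N.+1 -> 'cV[R]_(nv * nu)) k :=
  col_mx (y k - yo) (u k - uo).

Lemma mpc_cost_midpoint y u y' u' :
  cost (fun k => 2^-1 *: y k + (1 - 2^-1) *: y' k)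
       (fun k => 2^-1 *: u k + (1 - 2^-1) *: u' k) =
  2^-1 * cost y u + 2^-1 * cost y' u' -
  4^-1 * (\sum_(k < N) sqnorm Q (err y u (inord k) - err y' u' (inord k)) +
          sqnorm P (err y u ord_max - err y' u' ord_max)).
Proof.
have qh M k : quad_cost yo uo M (2^-1 *: y k + (1 - 2^-1) *: y' k)
                        (2^-1 *: u k + (1 - 2^-1) *: u' k) =
    2^-1 * quad_cost yo uo M (y k) (u k) + 2^-1 * quad_cost yo uo M (y' k) (u' k)
    - 4^-1 * sqnorm M (err y u k - err y' u' k).
  rewrite -sqnorm_midpoint /err !scale_col_mx add_col_mx /quad_cost.
  by congr (sqnorm M (col_mx _ _)); apply/colP => i; rewrite !mxE; field.
rewrite /mpc_cost qh; under eq_bigr do rewrite qh.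
by rewrite sumrB big_split /= -!mulr_sumr; ring.
Qed.

(* The midpoint with the optimizer is feasible, so the parallelogram identity
   bounds the distance by the excess cost. *)
Lemma optimizer_gap x y u y' u' (k : 'I_N) : posdef Q -> posdef P ->
  mpc_optimizer D yo uo gamma Q P x y u -> feasible x y' u' ->
  sqnorm Q (err y u (inord k) - err y' u' (inord k)) <=
  2 * (cost y' u' - cost y u).
Proof.
move=> pQ pP [fyu opt] fyu'.
have h0 : 0 <= 2^-1 :> R by lra.
have h1 : 2^-1 <= 1 :> R by lra.
have := opt _ _ (feasible_conv h0 h1 fyu fyu').
rewrite mpc_cost_midpoint (bigD1 k) //=.
set s := \sum_(i < N | _) _; have s0 : 0 <= s.
  by apply: sumr_ge0 => i _; exact: posdef_ge0.
have := posdef_ge0 (err y u ord_max - err y' u' ord_max) pP; lra.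
Qed.

(** The minimum is attained, so the infimum ranges over a nonempty set bounded below and its default
    value never enters. *)
Lemma mpc_value_optimizer x y u : mpc_optimizer D yo uo gamma Q P x y u ->
  mpc_value D N yo uo gamma Q P x = cost y u.
Proof.
move=> [fyu opt]; apply/eqP; rewrite eq_le; apply/andP; split.
  apply: ge_inf; last by exists y, u.
  by exists (cost y u) => _ [y' [u' [f' ->]]]; exact: opt.
apply: lb_le_inf; first by exists (cost y u), y, u.
by move=> _ [y' [u' [f' ->]]]; exact: opt.
Qed.

End TubeMPC.

(** * Convergence of the stage errors from the decrease of the optimal value *)

Lemma cvg_decrease (R : realType) (V : nat -> R) :
  (forall t, 0 <= V t) -> (forall t, V t.+1 <= V t) ->
  V t - V t.+1 @[t --> \oo] --> 0.
Proof.
move=> V0 Vd.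
have Vc : cvgn V.
  apply: nonincreasing_is_cvgn; first exact/nonincreasing_seqP.
  by exists 0 => _ [t _ <-].
have Vc' : V t.+1 @[t --> \oo] --> limn V by have := Vc; rewrite -cvg_shiftS.
by have := cvgB Vc Vc'; rewrite subrr; apply.
Qed.

Lemma stage_errors_cvg0 (R : realType) n N (Q : 'M[R]_n)
    (E : nat -> 'I_N.+1 -> 'cV[R]_n) (V : nat -> R) :
  posdef Q -> (forall t, 0 <= V t) ->
  (forall t, V t.+1 <= V t - sqnorm Q (E t ord0)) ->
  (forall t (k : 'I_N), sqnorm Q (E t.+1 (inord k) - E t (inord k.+1)) <=
     2 * (V t - V t.+1)) ->
  forall k, E t k @[t --> \oo] --> (0 : 'cV[R]_n).
Proof.
move=> pQ V0 Vd gap.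
have dV : V t - V t.+1 @[t --> \oo] --> 0.
  apply: cvg_decrease => // t; apply: le_trans (Vd t) _.
  by rewrite gerBl posdef_ge0.
have E0 : E t ord0 @[t --> \oo] --> (0 : 'cV[R]_n).
  apply: (posdef_cvg0 pQ).
  apply: (@squeeze_cvgr _ _ _ _ (fun=> 0) (fun t => V t - V t.+1)) => //.
    by apply: nearW => t; rewrite posdef_ge0 //=; have := Vd t; lra.
  exact: cvg_cst.
(* Induction on the stage: the error at k + 1 and time t is the error at k and time t + 1 minus a
   gap that tends to 0. *)
have Ek k : (k < N.+1)%N -> E t (inord k) @[t --> \oo] --> (0 : 'cV[R]_n).
  elim: k => [_|k IH kN].
    by rewrite (_ : inord 0 = ord0) //; apply: val_inj; rewrite /= inordK.
  have IHS : E t.+1 (inord k) @[t --> \oo] --> (0 : 'cV[R]_n).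
    by have := IH (ltnW kN); rewrite -cvg_shiftS.
  have dE : E t.+1 (inord k) - E t (inord k.+1) @[t --> \oo] --> (0 : 'cV[R]_n).
    apply: (posdef_cvg0 pQ).
    apply: (@squeeze_cvgr _ _ _ _ (fun=> 0) (fun t => 2 * (V t - V t.+1))).
    - by apply: nearW => t; rewrite posdef_ge0 //= (gap t (@Ordinal N k kN)).
    - exact: cvg_cst.
    - exact: cvg_mul0l.
  have -> : (fun t => E t (inord k.+1)) =
      fun t => E t.+1 (inord k) - (E t.+1 (inord k) - E t (inord k.+1)).
    by apply/funext => t; rewrite subKr.
  by have := cvgB IHS dE; rewrite subr0; apply.
by move=> k; have := Ek k (ltn_ord k); rewrite inord_val.
Qed.

Lemma cvg_col_mx0 (R : realType) m n (v : nat -> 'cV[R]_m) (w : nat -> 'cV[R]_n) :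
  col_mx (v t) (w t) @[t --> \oo] --> (0 : 'cV[R]_(m + n)) ->
  v t @[t --> \oo] --> (0 : 'cV[R]_m) /\ w t @[t --> \oo] --> (0 : 'cV[R]_n).
Proof.
move=> vw; have c i : col_mx (v t) (w t) i 0 @[t --> \oo] --> 0.
  by have := cvg_comp _ _ vw (@coord_continuous _ _ _ i 0 0); rewrite mxE.
split; apply: cvg_coord0 => i.
  by have := c (lshift n i); under eq_fun do rewrite col_mxEu.
by have := c (rshift m i); under eq_fun do rewrite col_mxEd.
Qed.

(** * The closed loop *)

Theorem theorem11 (R : realType) (nx nu nth nf nv np ne N : nat)
    (D : tube_data R nx nu nth nf nv np ne)
    (yo : 'cV[R]_nf) (uo : 'cV[R]_(nv * nu)) (gamma : R)
    (Q P : 'M[R]_(nf + nv * nu)) (Ru : 'M[R]_nu)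
    (ystar : 'cV[R]_nx -> 'I_N.+1 -> 'cV[R]_nf)
    (ustar : 'cV[R]_nx -> 'I_N.+1 -> 'cV[R]_(nv * nu))
    (lstar : 'cV[R]_nx -> 'cV[R]_nv) :
  let XN := feasible_states D N yo gamma in
  let mu := fun x => blend (lstar x) (ustar x ord0) in
  standing_assumptions D ->
  (1 <= N)%N ->
  posdef Q -> posdef P -> posdef Ru ->
  0 <= gamma -> gamma < 1 ->
  loewner_le (Q + gamma ^+ 2 *: P) P ->
  (forall x, XN x ->
     mpc_optimizer D yo uo gamma Q P x (ystar x) (ustar x)) ->
  (forall x, XN x ->
     weight_optimizer D Ru x (ystar x ord0) (ustar x ord0) (lstar x)) ->
  propagation D (yo, uo, yo) ->
  forall (x : nat -> 'cV[R]_nx) (th : nat -> 'cV[R]_nth) (w : nat -> 'cV[R]_nx),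
    XN (x 0%N) ->
    (forall t, Tset D (th t)) ->
    (forall t, Wset D (w t)) ->
    (forall t, x t.+1 = dyn D (xut (x t) (mu (x t)) (th t)) + w t) ->
    (forall t, XN (x t)) /\
    (mpc_value D N yo uo gamma Q P (x t) @[t --> \oo] --> 0) /\
    (forall k : 'I_N.+1,
       (ystar (x t) k, ustar (x t) k) @[t --> \oo] --> (yo, uo)).
Proof.
move=> XN mu hD N0 pQ pP pRu g0 g1 QP yopt lopt So x th w x0 thT wW dynx.
have step t : XN (x t) -> XN (x t.+1) /\
    mpc_feasible D yo gamma (x t.+1)
      (shift_tube gamma yo (ystar (x t))) (shift_tube gamma uo (ustar (x t))).
  move=> Xt; have [fopt _] := yopt _ Xt; have [lf _] := lopt _ Xt.
  have [_ S SN] := fopt.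
  have S0 := S (Ordinal N0).
  rewrite /= (_ : inord 0 = ord0) in S0; last by apply: val_inj; rewrite /= inordK.
  have Fx' : vle (Fmx D *m x t.+1) (ystar (x t) (inord 1)).
    by rewrite dynx; exact: propagation_step S0 lf (thT t) (wW t).
  have cand := shift_feasible hD N0 g0 g1 So fopt Fx'.
  split=> //; split; last by do 2!eexists; exact: cand.
  (* The successor state lies in X because the first set of the shifted tube contains it. *)
  have [Fc Sc _] := cand.
  have := Sc (Ordinal N0); rewrite /= (_ : inord 0 = ord0); last first.
    by apply: val_inj; rewrite /= inordK.
  by move=> /(propagation_Xset hD (np_gt0 hD)); apply.
have XNx t : XN (x t) by elim: t => [//|t /step[]].
pose V t := mpc_cost yo uo Q P (ystar (x t)) (ustar (x t)).
pose E t := err yo uo (ystar (x t)) (ustar (x t)).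
have V0 t : 0 <= V t.
  by rewrite addr_ge0 ?posdef_ge0 // sumr_ge0 // => k _; rewrite posdef_ge0.
have shift_le t := mpc_cost_shift yo uo (ystar (x t)) (ustar (x t)) QP.
have Ecvg : forall k, E t k @[t --> \oo] --> (0 : 'cV[R]_(nf + nv * nu)).
  apply: (stage_errors_cvg0 pQ V0) => [t|t k].
    have [_ cand] := step t (XNx t); have [_ opt] := yopt _ (XNx t.+1).
    exact: le_trans (opt _ _ cand) (shift_le t).
  (* The shifted tube competes at time t + 1 and costs at most [V t], so its excess cost is at most
     [V t - V t.+1]. *)
  have [_ cand] := step t (XNx t).
  have := optimizer_gap hD k pQ pP (yopt _ (XNx t.+1)) cand.
  rewrite /E /err !shift_tubeS => /le_trans; apply.
  rewrite ler_pM2l // lerD2r; apply: le_trans (shift_le t) _.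
  by rewrite gerBl posdef_ge0.
split=> //; split=> [|k].
  under eq_fun do rewrite (mpc_value_optimizer (yopt _ (XNx _))).
  (* Monotonicity alone gives only some limit of the value; that it is 0 follows since every stage
     error vanishes. *)
  rewrite -(addr0 (0 : R)); apply: cvgD; last exact: sqnorm_cvg0 (Ecvg ord_max).
  apply: (@cvg_sum0 _ _ _ (fun (k : 'I_N) t => sqnorm Q (E t (inord k)))) => k.
  exact: sqnorm_cvg0 (Ecvg _).
have [/subr_cvg0 yc /subr_cvg0 uc] := cvg_col_mx0 (Ecvg k).
exact: cvg_pair yc uc.
Qed.
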